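(* Every cyclic $4$-simplex of volume $V\in\mathbb{N}$ represented by one of the following $5$-tuples is empty. 1. $(\alpha+\beta,-\alpha,-\beta,-1,1)$, with $\alpha,\beta\in\mathbb{Z}$ and $\gcd(\alpha,\beta,V)=1$. 2. $(1,-2,\alpha,-2\alpha,1+\alpha)$, with $V$ odd, $\alpha\in\mathbb{Z}$, $\gcd(\alpha,V)=1$. 3. $\frac V2(0,1,0,1,0)+(-1,-1,\alpha,-\alpha,2)$, with $V\in4\mathbb{Z}$, $\alpha\in\mathbb{Z}$, $\gcd(\alpha,V)=1$. 4. Any of the following 29 tuples, with no prime factor of $V$ dividing two or more entries of the tuple: $(9,1,-2,-3,-5)$, $(9,2,-1,-4,-6)$, $(12,3,-4,-5,-6)$, $(12,2,-3,-4,-7)$, $(9,4,-2,-3,-8)$, $(12,1,-2,-3,-8)$, $(12,3,-1,-6,-8)$, $(15,4,-5,-6,-8)$, $(12,2,-1,-4,-9)$, $(10,6,-2,-5,-9)$, $(15,1,-2,-5,-9)$, $(12,5,-3,-4,-10)$, $(15,2,-3,-4,-10)$, $(6,4,3,-1,-12)$, $(7,5,3,-1,-14)$, $(9,7,1,-3,-14)$, $(15,7,-3,-5,-14)$, $(8,5,3,-1,-15)$, $(10,6,1,-2,-15)$, $(12,5,2,-4,-15)$, $(9,6,4,-1,-18)$, $(9,6,5,-2,-18)$, $(12,9,1,-4,-18)$, $(10,7,4,-1,-20)$, $(10,8,3,-1,-20)$, $(10,9,4,-3,-20)$, $(12,10,1,-3,-20)$, $(12,8,5,-1,-24)$, $(15,10,6,-1,-30)$.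 5. Any of the following 17 tuples, where $V$ is a multiple of the index $I$, $m:=\pm V/I$ for a choice of sign, and $m$ satisfies the indicated restrictions: Index $I=2$: $m(0,0,1,1,0)+(3,-1,-6,2,2)$, $m$ odd, $3\nmid m$; $m(1,0,0,0,1)+(4,-3,1,-4,2)$, $m$ odd; $m(1,0,0,0,1)+(2,3,-1,-8,4)$, $m$ odd; $m(0,1,1,0,0)+(1,-6,2,6,-3)$, $m$ odd, $3\nmid m$; $m(1,0,1,0,0)+(6,-8,4,-3,1)$, $m$ odd, $3\nmid m$; $m(1,0,0,0,1)+(4,3,-1,-12,6)$, $m$ odd, $3\nmid m$. Index $I=4$: $m(2,1,1,0,0)+(3,-3,1,-2,1)$, $m$ even, $3\nmid m$; $m(0,1,1,0,2)+(1,3,-1,-6,3)$, $m$ even, $3\nmid m$. Index $I=3$: $m(0,0,2,1,0)+(-3,2,1,1,-1)$, $m\equiv0\pmod 3$; $m(1,0,2,0,0)+(3,-3,1,-2,1)$, $m\equiv2\pmod 3$; $m(0,0,1,2,0)+(-3,1,2,2,-2)$, $m$ odd, $m\equiv0\pmod 3$; $m(0,0,1,2,0)+(4,-2,-4,1,1)$, $m$ odd, $m\not\equiv1\pmod 3$; $m(1,0,2,0,0)+(3,-6,2,2,-1)$, $m$ odd, $m\equiv1\pmod 3$; $m(1,0,2,0,0)+(4,-6,1,2,-1)$, $m$ odd, $m\equiv0\pmod 3$; $m(1,0,2,0,0)+(4,-3,1,-4,2)$, $m$ odd, $m\equiv0\pmod 3$; $m(0,0,1,1,1)+(1,-6,2,6,-3)$,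 $m$ odd, $m\equiv2\pmod 3$. Index $I=6$: $m(1,0,0,4,1)+(1,-3,1,2,-1)$, $m$ even, $m\equiv0\pmod 3$.
   Context: Fix a lattice $\Lambda\subset\mathbb{R}^d$ of rank $d$ (e.g. $\mathbb{Z}^d$). ''Volume'' always means normalized volume: a unimodular simplex (whose vertices form an affine $\mathbb{Z}$-basis of $\Lambda$) has volume $1$. An empty $d$-simplex is a lattice $d$-simplex (vertices in $\Lambda$) whose only lattice points are its vertices. For a lattice $d$-simplex $P=\operatorname{conv}(v_0,\dots,v_d)$, translated so that $v_0=0$, let $\Lambda_P$ be the lattice generated by the vertices and $G_P=\Lambda/\Lambda_P$, a finite abelian group of order equal to the volume $V$ of $P$. $P$ is cyclic if $G_P$ is cyclic. The barycentric coordinates of $p$ are the unique $(b_0,\dots,b_d)$ with $\sum b_i=1$ and $\sum b_iv_i=p$; those of a class in $G_P$ are defined modulo $\mathbb{Z}^{d+1}$. A $(d+1)$-tuple for (or representing) a cyclic simplex $P$ of volume $V$ is $V$ times the barycentric coordinates of any generator of $G_P$: an integer vector whose entries are considered modulo $V$. The volume and a tuple determine $P$ up to isomorphism (affine maps inducing lattice isomorphisms). *)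

(* Defs.v *)
From mathcomp Require Import all_boot all_order all_algebra.
From mathcomp Require Import classical_sets reals.

Set Implicit Arguments.
Unset Strict Implicit.
Unset Printing Implicit Defensive.

Import Order.TTheory GRing.Theory Num.Theory.
Local Open Scope classical_set_scope.
Local Open Scope ring_scope.

Section Simplices.
Variables (R : realType) (d : nat).

(* The Z-span of the rows of B; a lattice of rank d when B is invertible. *)
Definition lattice (B : 'M[R]_d) : set 'rV[R]_d :=
  [set p | exists z : 'rV[int]_d, p = map_mx intr z *m B].

Implicit Types (B : 'M[R]_d) (v : 'I_d.+1 -> 'rV[R]_d) (p g : 'rV[R]_d).

Definition barycentric v p (c : 'I_d.+1 -> R) : Prop :=
  \sum_i c i = 1 /\ \sum_i c i *: v i = p.

Definition conv v : set 'rV[R]_d :=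
  [set p | exists2 c, barycentric v p c & forall i, 0 <= c i].

Definition edges v : 'M[R]_d := \matrix_i (v (lift ord0 i) - v ord0).

Definition lattice_simplex B v : Prop :=
  row_free (edges v) /\ forall i, lattice B (v i).

(* d! times the Euclidean volume of conv v is |det (edges v)|; dividing by
   the covolume |det B| gives volume 1 to the unimodular simplices. *)
Definition normalized_volume B v : R := `|\det (edges v)| / `|\det B|.

Definition empty_simplex B v : Prop :=
  lattice_simplex B v /\
  forall p, conv v p -> lattice B p -> exists i, p = v i.

(* The simplex translated so that its vertex 0 is at the origin. Its vertices
   generate the lattice spanned by the edges of v. *)
Definition translated v : 'I_d.+1 -> 'rV[R]_d := fun i => v i - v ord0.

Definition vertex_lattice v : set 'rV[R]_d := lattice (edges v).

(* The class of g generates the group lattice B / vertex_lattice v. *)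
Definition generates B v g : Prop :=
  lattice B g /\
  forall p, lattice B p -> exists k : int, vertex_lattice v (p - g *~ k).

Definition cyclic_simplex B v : Prop := exists g, generates B v g.

(* Entries of t are only considered modulo V: V times the barycentric
   coordinates of a generator are congruent to t. *)
Definition represents B v (V : nat) (t : d.+1.-tuple int) : Prop :=
  exists g c, [/\ generates B v g, barycentric (translated v) g c &
    forall i, exists z : int, V%:R * c i = (tnth t i + V%:Z * z)%:~R].

End Simplices.

Definition family1 (V : nat) (t : 5.-tuple int) : Prop :=
  exists a b : int, gcdz (gcdz a b) V%:Z = 1 /\
    t = [tuple a + b; - a; - b; -1; 1].

Definition family2 (V : nat) (t : 5.-tuple int) : Prop :=
  exists a : int, [/\ odd V, gcdz a V%:Z = 1 &
    t = [tuple 1; -2; a; - (2 * a); 1 + a]].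

(* The 5-tuple m u + w. *)
Definition affine_tuple (m : int) (u w : 5.-tuple int) : 5.-tuple int :=
  [tuple m * tnth u i + tnth w i | i < 5].

Definition family3 (V : nat) (t : 5.-tuple int) : Prop :=
  exists a : int, [/\ (4 %| V)%N, gcdz a V%:Z = 1 &
    t = affine_tuple (V %/ 2)%N%:Z
          [tuple 0; 1; 0; 1; 0] [tuple -1; -1; a; - a; 2]].

Definition stable_tuples : seq (5.-tuple int) := [::
  [tuple 9; 1; -2; -3; -5];
  [tuple 9; 2; -1; -4; -6];
  [tuple 12; 3; -4; -5; -6];
  [tuple 12; 2; -3; -4; -7];
  [tuple 9; 4; -2; -3; -8];
  [tuple 12; 1; -2; -3; -8];
  [tuple 12; 3; -1; -6; -8];
  [tuple 15; 4; -5; -6; -8];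
  [tuple 12; 2; -1; -4; -9];
  [tuple 10; 6; -2; -5; -9];
  [tuple 15; 1; -2; -5; -9];
  [tuple 12; 5; -3; -4; -10];
  [tuple 15; 2; -3; -4; -10];
  [tuple 6; 4; 3; -1; -12];
  [tuple 7; 5; 3; -1; -14];
  [tuple 9; 7; 1; -3; -14];
  [tuple 15; 7; -3; -5; -14];
  [tuple 8; 5; 3; -1; -15];
  [tuple 10; 6; 1; -2; -15];
  [tuple 12; 5; 2; -4; -15];
  [tuple 9; 6; 4; -1; -18];
  [tuple 9; 6; 5; -2; -18];
  [tuple 12; 9; 1; -4; -18];
  [tuple 10; 7; 4; -1; -20];
  [tuple 10; 8; 3; -1; -20];
  [tuple 10; 9; 4; -3; -20];
  [tuple 12; 10; 1; -3; -20];
  [tuple 12; 8; 5; -1; -24];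
  [tuple 15; 10; 6; -1; -30]].

Definition family4 (V : nat) (t : 5.-tuple int) : Prop :=
  t \in stable_tuples /\
  forall q : nat, prime q -> (q %| V)%N ->
    (count (fun x : int => (q%:Z %| x)%Z) t <= 1)%N.

Definition odd_int (m : int) : Prop := (m = 1 %[mod 2])%Z.
Definition even_int (m : int) : Prop := (m = 0 %[mod 2])%Z.

(* index_tuple I m t: t is one of the tuples of index I, with parameter m. *)
Inductive index_tuple (m : int) : nat -> 5.-tuple int -> Prop :=
| Index2_1 of odd_int m & ~~ (3 %| m)%Z :
    index_tuple m 2 (affine_tuple m [tuple 0; 0; 1; 1; 0] [tuple 3; -1; -6; 2; 2])
| Index2_2 of odd_int m :
    index_tuple m 2 (affine_tuple m [tuple 1; 0; 0; 0; 1] [tuple 4; -3; 1; -4; 2])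
| Index2_3 of odd_int m :
    index_tuple m 2 (affine_tuple m [tuple 1; 0; 0; 0; 1] [tuple 2; 3; -1; -8; 4])
| Index2_4 of odd_int m & ~~ (3 %| m)%Z :
    index_tuple m 2 (affine_tuple m [tuple 0; 1; 1; 0; 0] [tuple 1; -6; 2; 6; -3])
| Index2_5 of odd_int m & ~~ (3 %| m)%Z :
    index_tuple m 2 (affine_tuple m [tuple 1; 0; 1; 0; 0] [tuple 6; -8; 4; -3; 1])
| Index2_6 of odd_int m & ~~ (3 %| m)%Z :
    index_tuple m 2 (affine_tuple m [tuple 1; 0; 0; 0; 1] [tuple 4; 3; -1; -12; 6])
| Index4_1 of even_int m & ~~ (3 %| m)%Z :
    index_tuple m 4 (affine_tuple m [tuple 2; 1; 1; 0; 0] [tuple 3; -3; 1; -2; 1])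
| Index4_2 of even_int m & ~~ (3 %| m)%Z :
    index_tuple m 4 (affine_tuple m [tuple 0; 1; 1; 0; 2] [tuple 1; 3; -1; -6; 3])
| Index3_1 of (m = 0 %[mod 3])%Z :
    index_tuple m 3 (affine_tuple m [tuple 0; 0; 2; 1; 0] [tuple -3; 2; 1; 1; -1])
| Index3_2 of (m = 2 %[mod 3])%Z :
    index_tuple m 3 (affine_tuple m [tuple 1; 0; 2; 0; 0] [tuple 3; -3; 1; -2; 1])
| Index3_3 of odd_int m & (m = 0 %[mod 3])%Z :
    index_tuple m 3 (affine_tuple m [tuple 0; 0; 1; 2; 0] [tuple -3; 1; 2; 2; -2])
| Index3_4 of odd_int m & (m <> 1 %[mod 3])%Z :
    index_tuple m 3 (affine_tuple m [tuple 0; 0; 1; 2; 0] [tuple 4; -2; -4; 1; 1])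
| Index3_5 of odd_int m & (m = 1 %[mod 3])%Z :
    index_tuple m 3 (affine_tuple m [tuple 1; 0; 2; 0; 0] [tuple 3; -6; 2; 2; -1])
| Index3_6 of odd_int m & (m = 0 %[mod 3])%Z :
    index_tuple m 3 (affine_tuple m [tuple 1; 0; 2; 0; 0] [tuple 4; -6; 1; 2; -1])
| Index3_7 of odd_int m & (m = 0 %[mod 3])%Z :
    index_tuple m 3 (affine_tuple m [tuple 1; 0; 2; 0; 0] [tuple 4; -3; 1; -4; 2])
| Index3_8 of odd_int m & (m = 2 %[mod 3])%Z :
    index_tuple m 3 (affine_tuple m [tuple 0; 0; 1; 1; 1] [tuple 1; -6; 2; 6; -3])
| Index6_1 of even_int m & (m = 0 %[mod 3])%Z :
    index_tuple m 6 (affine_tuple m [tuple 1; 0; 0; 4; 1] [tuple 1; -3; 1; 2; -1]).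

(* The sign of m is free. *)
Definition family5 (V : nat) (t : 5.-tuple int) : Prop :=
  exists (I : nat) (m : int), [/\ (I %| V)%N,
    m = (V %/ I)%N%:Z \/ m = - (V %/ I)%N%:Z & index_tuple m I t].

(* Main.v *)
Require Import Defs.
From mathcomp Require Import all_boot all_order all_algebra.
From mathcomp Require Import classical_sets reals.
From mathcomp Require Import zify ring.

(** A lattice point of the simplex has barycentric coordinates [x_i / V] with
    [x_i] nonnegative integers of sum [V]. Its class is a multiple [k] of the
    generator, so [x_i] is congruent to [k t_i] modulo [V]. Hence the simplex
    is empty as soon as every such [x] has an entry equal to [V]: this is the
    arithmetic property [only_vertices V t], and [empty_of_only_vertices] is
    the reduction to it.

    For the three families given by formulas, [only_vertices] follows from
    entries, or integer combinations of entries, that are congruent to [0]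
    modulo [V] and are squeezed between [0] and a small multiple of [V]; the
    conclusion is always that [V] divides [k], and then every [x_i] is [0] or
    [V].

    In the other families [t = M u + w] and [V = I M], with [u] and [w] taken
    from a finite list, [w] of sum [0] and [u] of sum [e I]. If no [x_i] is
    [V], then [x_i = k t_i - q_i V] with
    [q_i = floor (k u_i / I + (k / V) w_i)], and [sum_i x_i = V] says that the
    [q_i] add up to [k e - 1]. Replacing [k] by its remainder [r] modulo [I]
    in the first term only, and writing [theta = k / V], this becomes
    [sum_i floor (r u_i / I + theta w_i) = r e - 1]. As a function of [theta]
    the left side jumps only at the multiples of [1 / (I L)], where [L] is a
    common multiple of the [w_i], so finitely many evaluations decide for which
    [theta] the equation holds ([grid_check], [grid_only_vertices]). It never
    holds inside a cell of this grid. It does hold at some grid points, but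
    [k / V = j / (I L)] constrains [M] ([reduced_position]), and the
    divisibility conditions on [V] or on [m] are exactly what rules these
    points out. *)

Set Implicit Arguments.
Unset Strict Implicit.
Unset Printing Implicit Defensive.

Import Order.TTheory GRing.Theory Num.Theory.
Local Open Scope ring_scope.

(** * From lattice points to residues *)

(** The [x_i] are [V] times the barycentric coordinates of a lattice point of
    the simplex in the class of [k] times the generator represented by [t]. *)
Definition only_vertices n (V : nat) (t : n.-tuple int) : Prop :=
  forall (k : int) (x : 'I_n -> int),
    (forall i, 0 <= x i) -> \sum_i x i = V ->
    (forall i, (V %| x i - k * tnth t i)%Z) -> exists i, x i = V.

Section Barycentric.
Variables (R : realType) (d : nat).
Implicit Types (B : 'M[R]_d) (v : 'I_d.+1 -> 'rV[R]_d) (p g : 'rV[R]_d).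

Lemma barycentric_edges v p c : barycentric v p c ->
  (\row_j c (lift ord0 j)) *m edges v = p - v ord0.
Proof.
case=> sum_c <-; rewrite mulmx_sum_row.
rewrite -[v ord0 in RHS]scale1r -sum_c scaler_suml -sumrB big_ord_recl subrr add0r.
by apply: eq_bigr => j _; rewrite rowK mxE scalerBr.
Qed.

Lemma edges_translated v : edges (translated v) = edges v.
Proof. by apply/row_matrixP=> j; rewrite !rowK /translated subrr subr0. Qed.

Lemma latticeB B p q : lattice B p -> lattice B q -> lattice B (p - q).
Proof.
by move=> [y ->] [z ->]; exists (y - z); rewrite map_mxB mulmxBl.
Qed.

(** Away from vertex [0] this is the independence of the edges; the coordinate
    at vertex [0] is determined by the others because coordinates sum to [1]. *)
Lemma class_coordinates v p g (k : int) c a : row_free (edges v) ->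
    barycentric v p c -> barycentric (translated v) g a ->
    vertex_lattice v (p - v ord0 - g *~ k) ->
  exists z : 'I_d.+1 -> int, forall i, c i = a i *~ k + (z i)%:~R.
Proof.
move=> free_v bc ba [z def_pg].
have ca j : c (lift ord0 j) = a (lift ord0 j) *~ k + (z ord0 j)%:~R.
  have := barycentric_edges ba.
  rewrite edges_translated /translated subrr subr0 => def_g.
  move: def_pg; rewrite -(barycentric_edges bc) -{}def_g => /eqP.
  rewrite subr_eq addrC -scaler_int scalemxAl -mulmxDl => /eqP.
  by move/(row_free_inj free_v)/rowP/(_ j); rewrite !mxE mulrzl.
exists (fun i => if unlift ord0 i is Some j then z ord0 j
                 else 1 - k - \sum_j z ord0 j) => i.
case: unliftP => [j|] ->; first exact: ca.
have rest (b : 'I_d.+1 -> R) : \sum_i b i = 1 ->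
    b ord0 = 1 - \sum_j b (lift ord0 j).
  by move=> <-; rewrite big_ord_recl addrK.
rewrite (rest c bc.1) (rest a ba.1); under eq_bigr do rewrite ca -mulrzl.
rewrite big_split /= -mulr_sumr -(rmorph_sum intr) /= -mulrzl.
by rewrite !rmorphB /=; ring.
Qed.

Lemma empty_of_only_vertices B v V t : (0 < V)%N -> lattice_simplex B v ->
  represents B v V t -> only_vertices V t -> empty_simplex B v.
Proof.
move=> V_gt0 simplex_v [g [a [[_ gen_g] ba ta]]] only_t; split=> // p.
move=> [c bc c_ge0] Bp.
have V_neq0: V%:R != 0 :> R by rewrite pnatr_eq0 -lt0n.
have [k /(class_coordinates simplex_v.1 bc ba)[z cE]] :=
  gen_g _ (latticeB Bp (simplex_v.2 ord0)).
have [y yE] := fin_all_exists ta.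
pose x i : int := k * (tnth t i + V%:Z * y i) + V%:Z * z i.
have xE i : (x i)%:~R = V%:R * c i.
  by rewrite cE mulrDr -[a i *~ k]mulrzl mulrCA yE rmorphD !rmorphM.
have x_ge0 i : 0 <= x i by rewrite -(ler0z R) xE mulr_ge0 ?ler0n.
have sum_x : \sum_i x i = V.
  apply: (@intr_inj R); rewrite rmorph_sum /=.
  by under eq_bigr do rewrite xE; rewrite -mulr_sumr bc.1 mulr1.
have [|i xi] := only_t k x x_ge0 sum_x.
  by move=> i; apply/dvdzP; exists (k * y i + z i); rewrite /x; ring.
have ci : c i = 1 by apply: (mulfI V_neq0); rewrite -xE xi mulr1.
exists i; rewrite -bc.2 (bigD1 i) //= ci scale1r big1 ?addr0 // => j ji.
have sum_c : \sum_(j | j != i) c j = 0.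
  by move: bc.1; rewrite (bigD1 i) //= ci -[RHS]addr0 => /addrI.
by rewrite (psumr_eq0P _ sum_c) ?scale0r // => l _; apply: c_ge0.
Qed.

Lemma normalized_volume_gt0 B v : B \in unitmx -> row_free (edges v) ->
  0 < normalized_volume B v.
Proof.
by rewrite row_free_unit !unitmxE !unitfE -!normr_gt0 => *; apply: divr_gt0.
Qed.

End Barycentric.

(** * Families given by formulas *)

Section Formulas.
Variable V : nat.
Hypothesis V_gt0 : (0 < V)%N.

Lemma coordinate_le n (x : 'I_n -> int) i :
  (forall i, 0 <= x i) -> \sum_i x i = V -> x i <= V.
Proof.
by move=> x_ge0 <-; rewrite (bigD1 i) //= lerDl sumr_ge0.
Qed.

Lemma multiple_between (a b q : int) :
  a * V < q * V -> q * V < b * V -> a < q < b.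
Proof. by rewrite !ltr_pM2r ?ltz_nat // => -> ->. Qed.

Lemma dvdz_box (x : int) : (V %| x)%Z -> 0 <= x -> x <= V -> x = 0 \/ x = V.
Proof.
move=> /dvdzP[q ->] q_ge0 q_le.
have q01 : -1 < q < 2 by apply: multiple_between; lia.
have [->|->] : q = 0 \/ q = 1 by lia.
  by left; rewrite mul0r.
by right; rewrite mul1r.
Qed.

(** The trivial class contains only vertices: its coordinates are multiples of
    [V] between [0] and [V]. *)
Lemma only_vertices_from_dvd n (t : n.-tuple int) :
    (forall (k : int) (x : 'I_n -> int),
       (forall i, 0 <= x i) -> \sum_i x i = V ->
       (forall i, (V %| x i - k * tnth t i)%Z) -> (V %| k)%Z) ->
  only_vertices V t.
Proof.
move=> dvd_k k x x_ge0 sum_x xt; have Vk := dvd_k k x x_ge0 sum_x xt.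
have [i /eqP xi|x_neqV] := pickP (fun i => x i == V); first by exists i.
suff x0 i : x i = 0 by move: sum_x; rewrite big1 // => V0; lia.
have Vx : (V %| x i)%Z.
  by rewrite -[x i](subrK (k * tnth t i)) rpredD ?dvdz_mulr.
have [//|xV] := dvdz_box Vx (x_ge0 i) (coordinate_le i x_ge0 sum_x).
by have := x_neqV i; rewrite xV eqxx.
Qed.

Lemma only_vertices5 (t0 t1 t2 t3 t4 : int) :
    (forall k x0 x1 x2 x3 x4 q0 q1 q2 q3 q4 : int,
       [/\ 0 <= x0, 0 <= x1, 0 <= x2, 0 <= x3 & 0 <= x4] ->
       x0 + x1 + x2 + x3 + x4 = V ->
       [/\ x0 = k * t0 + q0 * V, x1 = k * t1 + q1 * V, x2 = k * t2 + q2 * V,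
           x3 = k * t3 + q3 * V & x4 = k * t4 + q4 * V] -> (V %| k)%Z) ->
  only_vertices V [tuple t0; t1; t2; t3; t4].
Proof.
move=> dvd_k; apply: only_vertices_from_dvd => k x x_ge0.
rewrite !big_ord_recl big_ord0 addr0 !addrA => sum_x xt.
have /fin_all_exists[q qE] i :
    exists q : int, x i = k * tnth [tuple t0; t1; t2; t3; t4] i + q * V.
  by have /dvdzP[q qE] := xt i; exists q; rewrite -qE addrC subrK.
by apply: (dvd_k k _ _ _ _ _ _ _ _ _ _ _ sum_x); split=> //; apply: qE.
Qed.

Lemma gauss_dvd (k a : int) : gcdz a V = 1 -> (V %| k * a)%Z -> (V %| k)%Z.
Proof. by move=> aV; rewrite Gauss_dvdzl // /coprimez gcdzC aV. Qed.

(** The entries [-1] and [1] make [x3 + x4] equal to [0] or [V]. In the first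
    case [x4 = 0]; in the second [x1 = x2 = 0], so [V] divides [k a] and
    [k b]. *)
Lemma only_vertices_family1 t : family1 V t -> only_vertices V t.
Proof.
move=> [a [b [abV ->]]]; apply: only_vertices5.
move=> k x0 x1 x2 x3 x4 q0 q1 q2 q3 q4 [? ? ? ? ?] sum_x [E0 E1 E2 E3 E4].
have V34 : (V %| x3 + x4)%Z by apply/dvdzP; exists (q3 + q4); lia.
have [||x34|x34] := dvdz_box V34; try lia.
  by apply/dvdzP; exists (- q4); lia.
have Vka : (V %| k * a)%Z by apply/dvdzP; exists q1; lia.
have Vkb : (V %| k * b)%Z by apply/dvdzP; exists q2; lia.
suff: (V %| `|k|)%Z by rewrite !dvdzE -[in X in X -> _]abszE.
by apply: (gauss_dvd abV); rewrite mulz_gcdr dvdz_gcd Vka.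
Qed.

(** If [x0] or [x2] vanishes, then [V] divides [k] or [k a]. Otherwise
    [2 x0 + x1] and [2 x2 + x3] are positive multiples of [V], and their sum is
    at most [2 V], so both equal [V]. The total being [V], this leaves
    [x0 + x2 = V + x4], which with [x0, x2 <= V / 2] forces [2 x0 = V]: no
    solution for odd [V]. *)
Lemma only_vertices_family2 t : family2 V t -> only_vertices V t.
Proof.
move=> [a [oddV aV ->]]; apply: only_vertices5.
move=> k x0 x1 x2 x3 x4 q0 q1 q2 q3 q4 [? ? ? ? ?] sum_x [E0 E1 E2 E3 E4].
have [p p_def] : {p | p = 2 * q0 + q1} by exists (2 * q0 + q1).
have [q q_def] : {q | q = 2 * q2 + q3} by exists (2 * q2 + q3).
have E01 : 2 * x0 + x1 = p * V by rewrite p_def; lia.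
have E23 : 2 * x2 + x3 = q * V by rewrite q_def; lia.
have [x00|x0_neq0] := eqVneq x0 0; first by apply/dvdzP; exists (- q0); lia.
have [x20|x2_neq0] := eqVneq x2 0.
  by apply: (gauss_dvd aV); apply/dvdzP; exists (- q2); lia.
have p1 : p = 1 by have := @multiple_between 0 2 p; lia.
have q1' : q = 1 by have := @multiple_between 0 2 q; lia.
by subst p q; lia.
Qed.

(** Write [V = 4 W] and suppose that [x0] and [x2] are nonzero. For even [k]
    the sum [x2 + x3] is [0] or [V], so [x2] or [x0] vanishes after all. For
    odd [k], [x2 + x3 = 2 W], and [x0 - x1], being congruent to [2 W] modulo
    [V], is [2 W] in absolute value; the bound on the total then gives
    [x0 = 2 W], whence [k] is even. *)
Lemma only_vertices_family3 t : family3 V t -> only_vertices V t.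
Proof.
move=> [a [V4 aV ->]].
have [W def_V] : exists W : nat, V = (4 * W)%N.
  by have /dvdnP[W ->] := V4; exists W; rewrite mulnC.
have -> : affine_tuple (V %/ 2)%N [tuple 0; 1; 0; 1; 0] [tuple -1; -1; a; - a; 2]
    = [tuple -1; 2 * W%:Z - 1; a; 2 * W%:Z - a; 2].
  have -> : (V %/ 2 = 2 * W)%N by lia.
  apply/eq_from_tnth=> -[[|[|[|[|[|]]]]] lt_i5] //;
    by rewrite tnth_mktuple !(tnth_nth 0) /=; lia.
apply: only_vertices5.
move=> k x0 x1 x2 x3 x4 q0 q1 q2 q3 q4 [? ? ? ? ?] sum_x [E0 E1 E2 E3 E4].
have VE : V%:Z = 4 * W%:Z by lia.
have [h kE] : exists h : int, k = 2 * h \/ k = 2 * h + 1.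
  by exists (k %/ 2)%Z; lia.
have [x00|x0_neq0] := eqVneq x0 0; first by apply/dvdzP; exists q0; lia.
have [x20|x2_neq0] := eqVneq x2 0.
  by apply: (gauss_dvd aV); apply/dvdzP; exists (- q2); lia.
case: kE => kE.
  have V23 : (V %| x2 + x3)%Z by apply/dvdzP; exists (q2 + q3 + h); subst k; lia.
  by have [||x23|x23] := dvdz_box V23; lia.
have [p p_def] : {p | p = q2 + q3 + h + 1} by exists (q2 + q3 + h + 1).
have E23 : x2 + x3 + 2 * W%:Z = p * V by rewrite p_def; lia.
have p1 : p = 1 by have := @multiple_between 0 2 p; lia.
have [r r_def] : {r | r = q0 - q1 - h} by exists (q0 - q1 - h).
have E01 : x0 - x1 + 2 * W%:Z = r * V by rewrite r_def VE; subst k; lia.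
have r01 : -1 < r < 2 by apply: multiple_between; subst p; lia.
have [?|?] : r = 0 \/ r = 1 by lia.
  by subst r p; lia.
by subst r p; lia.
Qed.

End Formulas.

(** * Sums of floors on a grid *)

(** For [uw = (u, w)], the floor of [r u / I + theta w], where [theta] is the
    grid point [j / (I L)] or, if [inside], any point of the open cell that
    starts there. Numerator and denominator have been scaled so that [theta w]
    moves in unit steps from one grid point to the next; hence inside a cell
    the floor is that of the left endpoint when [w] is positive, and drops
    by one unit of the numerator when [w] is negative. *)
Definition cell_floor (I L : nat) (inside : bool) (r j : nat) (uw : int * int) : int :=
  let a := (L %/ `|uw.2|)%N in
  ((r%:Z * a%:Z * uw.1 + (if 0 <= uw.2 then j%:Z else - j%:Z - inside%:Z))
     %/ (I * a)%N%:Z)%Z.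

Definition cell_sum I L inside r j (u w : seq int) : int :=
  foldr +%R 0 (map (cell_floor I L inside r j) (zip u w)).

(** Grid points where the equation holds are accepted only if [excluded]; no
    such exception is made for the open cells. *)
Definition grid_check (I L : nat) (e : int) (excluded : nat -> nat -> bool)
    (u w : seq int) : bool :=
  [&& (0 < I)%N, (0 < L)%N, all (fun x : int => (x != 0) && (`|x| %| L)%N) w,
      foldr +%R 0 u == I%:Z * e, foldr +%R 0 w == 0 &
      all (fun r => all (fun j =>
        (cell_sum I L true r j u w != r%:Z * e - 1) &&
        ((cell_sum I L false r j u w != r%:Z * e - 1) || excluded r j))
      (iota 0 (I * L))) (iota 0 I)].

Lemma grid_check_gt0 I L e excluded u w : grid_check I L e excluded u w -> (0 < L)%N.
Proof. by case/and3P. Qed.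

(** Here [theta = k / (I M)] lies in the [j]-th cell, at its left endpoint
    exactly when [h = 0]. *)
Lemma cell_floorP (I L M r j h k : nat) (u w q : int) :
    (0 < I)%N -> (0 < L)%N -> w != 0 -> (`|w| %| L)%N ->
    (h < M)%N -> (k * L = j * M + h)%N ->
    q * (I * M)%N <= r%:Z * M%:Z * u + k%:Z * w < (q + 1) * (I * M)%N ->
  cell_floor I L (h != 0)%N r j (u, w) = q.
Proof.
move=> I_gt0 L_gt0 w_neq0 /dvdnP[a def_L] h_ltM kL /andP[q_le lt_q].
have w_gt0 : (0 < `|w|)%N by rewrite absz_gt0.
have a_gt0 : 0 < a%:Z.
  by rewrite ltz_nat; move: L_gt0; rewrite def_L muln_gt0 => /andP[].
rewrite /cell_floor /= {1 2}def_L mulnK // PoszM.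
set rho := _ + _; set d := (I%:Z * a%:Z).
have M_gt0 : 0 < M%:Z by lia.
have d_gt0 : 0 < d by rewrite mulr_gt0.
(* Multiplying by [a] turns [k w] into [k L] up to sign, and [rho] is the
   quotient by [M] of the result. *)
have [h' /andP[h'_ge0 h'_lt] scaledE] : exists2 h' : int, 0 <= h' < M%:Z &
    a%:Z * (r%:Z * M%:Z * u + k%:Z * w) = rho * M%:Z + h'.
  have kL' : k%:Z * (a%:Z * `|w|%N) = j%:Z * M%:Z + h%:Z by lia.
  rewrite /rho; case: (lerP 0 w) => w_sign.
    exists h%:Z; first by lia.
    by move: kL'; rewrite gez0_abs // => kL'; lia.
  exists (if h == 0%N then 0 else M%:Z - h%:Z); first by case: eqP; lia.
  by move: kL'; rewrite ltz0_abs // => kL'; case: eqP => [h0|h0]; lia.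
have q_le_rho : q * d <= rho.
  rewrite -ltzD1 -(ltr_pM2r M_gt0).
  have : a%:Z * (q * (I * M)%N) <= rho * M%:Z + h' by rewrite -scaledE ler_pM2l.
  by rewrite /d; lia.
have rho_lt : rho < (q + 1) * d.
  rewrite -(ltr_pM2r M_gt0).
  have : rho * M%:Z + h' < a%:Z * ((q + 1) * (I * M)%N).
    by rewrite -scaledE ltr_pM2l.
  by rewrite /d; lia.
rewrite -(subrK (q * d) rho) addrC divzMDl ?gt_eqF // divz_small ?addr0 //.
by rewrite gtz0_abs //; lia.
Qed.

(** A solution [x] without an entry equal to [V = I M] is made of remainders of
    [k t_i] modulo [V]; the quotients then satisfy the equation tested by
    [grid_check] at [theta = k / V]. *)
Lemma grid_only_vertices n (I L M : nat) e excluded (u w t : n.-tuple int) :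
    (0 < M)%N -> grid_check I L e excluded u w ->
    (forall i, tnth t i = M%:Z * tnth u i + tnth w i) ->
    (forall j k, k * L = j * M -> ~~ excluded (k %% I) j)%N ->
  only_vertices (I * M)%N t.
Proof.
rewrite /grid_check !foldrE !big_tuple.
move=> M_gt0 /and5P[I_gt0 L_gt0 w_ok /eqP sum_u /andP[/eqP sum_w grid]] tE adm.
have V_gt0 : (0 < I * M)%N by rewrite muln_gt0 I_gt0.
move=> k0 x x_ge0 sum_x xt0.
have [i /eqP xi|x_neqV] := pickP (fun i => x i == (I * M)%N); first by exists i.
have x_lt i : x i < (I * M)%N.
  by rewrite lt_neqAle x_neqV coordinate_le.
(* Only the class of [k0] modulo [V] matters; this puts [theta] in [0, 1). *)
pose k := `|(k0 %% (I * M)%N)%Z|%N.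
have kE : k%:Z = (k0 %% (I * M)%N)%Z by rewrite gez0_abs // modz_ge0; lia.
have k_lt : (k < I * M)%N by rewrite -ltz_nat kE ltz_pmod.
have /fin_all_exists[q0 q0E] i :
    exists q : int, k%:Z * tnth t i = x i + q * (I * M)%N.
  have /dvdzP[q qE] := xt0 i.
  exists (- q - (k0 %/ (I * M)%N)%Z * tnth t i).
  have := divz_eq k0 (I * M)%N; rewrite -kE => k0E.
  by move: qE; rewrite {1}k0E => qE; lia.
pose r := (k %% I)%N; pose y := (k %/ I)%N.
pose j := (k * L %/ M)%N; pose h := (k * L %% M)%N.
pose q i := q0 i - y%:Z * tnth u i.
have qE i : r%:Z * M%:Z * tnth u i + k%:Z * tnth w i = x i + q i * (I * M)%N.
  have kI : k%:Z = y%:Z * I%:Z + r%:Z by rewrite {1}(divn_eq k I) PoszD PoszM.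
  by have := q0E i; rewrite tE kI /q PoszM; lia.
have cellE i : cell_floor I L (h != 0)%N r j (tnth u i, tnth w i) = q i.
  have /andP[w_neq0 w_dvd] := allP w_ok _ (mem_tnth i w).
  apply: (@cell_floorP I L M r j h k) => //; first by rewrite ltn_mod.
    by rewrite -divn_eq.
  by rewrite qE; have := x_ge0 i; have := x_lt i; lia.
have sum_q : \sum_i q i = r%:Z * e - 1.
  apply: (@mulIf _ (I * M)%N%:Z); first by lia.
  rewrite mulr_suml; under eq_bigr => i _.
    rewrite (_ : q i * _ = r%:Z * M%:Z * tnth u i + k%:Z * tnth w i - x i).
      over.
    by rewrite qE addrAC subrr add0r.
  rewrite sumrB big_split /= -!mulr_sumr sum_u sum_w sum_x PoszM.
  by ring.
have sum_cell : cell_sum I L (h != 0)%N r j u w = r%:Z * e - 1.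
  rewrite -sum_q /cell_sum foldrE big_map (big_tuple _ _ (zip_tuple u w)) /=.
  apply: eq_bigr => i _; rewrite -cellE; congr cell_floor.
  rewrite (tnth_nth (tnth u i, tnth w i)) /= nth_zip ?size_tuple //.
  by rewrite -!tnth_nth.
have := allP (allP grid r _) j _; rewrite !mem_iota /= !add0n ltn_mod I_gt0.
have j_lt : (j < I * L)%N.
  by rewrite ltn_divLR // mulnAC ltn_mul2r L_gt0.
rewrite j_lt => /(_ isT isT) /andP[].
have [h0|h_neq0] := eqVneq h 0%N.
  move: sum_cell; rewrite h0 eqxx /= => ->; rewrite eqxx /= => _.
  have kL : (k * L = j * M)%N by rewrite [LHS](divn_eq _ M) -/h h0 addn0.
  by rewrite (negPf (adm j k kL)).
by move: sum_cell; rewrite h_neq0 => ->; rewrite eqxx.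
Qed.

(** Since [k / M = j / L], reducing [j / L] to lowest terms gives a divisor of
    [M]. *)
Lemma reduced_position (L M k j : nat) : (0 < L)%N -> (k * L = j * M)%N ->
  exists2 m : nat, M = (L %/ gcdn L j * m)%N & k = (j %/ gcdn L j * m)%N.
Proof.
move=> L_gt0 kL; have g_gt0 : (0 < gcdn L j)%N by rewrite gcdn_gt0 L_gt0.
set L' := (L %/ _)%N; set j' := (j %/ _)%N.
have def_L : L = (L' * gcdn L j)%N by rewrite divnK ?dvdn_gcdl.
have def_j : j = (j' * gcdn L j)%N by rewrite divnK ?dvdn_gcdr.
have L'_gt0 : (0 < L')%N by move: L_gt0; rewrite {1}def_L muln_gt0 => /andP[].
have kL' : (k * L' = j' * M)%N.
  apply/eqP; rewrite -(eqn_pmul2r g_gt0) -mulnA -def_L kL {1}def_j.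
  by rewrite mulnAC.
have co_L'j' : coprime L' j'.
  by rewrite /coprime -(eqn_pmul2r g_gt0) mul1n muln_gcdl -def_L -def_j.
have /dvdnP[m def_M] : (L' %| M)%N.
  by rewrite -(Gauss_dvdr _ co_L'j') -kL' dvdn_mull.
exists m; first by rewrite mulnC.
by apply/eqP; rewrite -(eqn_pmul2r L'_gt0) kL' def_M; apply/eqP; ring.
Qed.

Definition common_multiple (w : seq int) : nat :=
  foldr (fun x : int => lcmn `|x|) 1%N w.

(** * The tuples that do not depend on the volume *)

(** [theta = j / L] needs a volume divisible by [L / gcd (L, j)], which is
    forbidden if a prime factor of the latter divides two entries. All entries
    of the listed tuples factor into [2], [3], [5] and [7]. *)
Definition blocked_by_prime (t : seq int) (L r j : nat) : bool :=
  has (fun p => (p %| L %/ gcdn L j)%N &&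
                (1 < count (fun x : int => (p%:Z %| x)%Z) t)%N)
    [:: 2; 3; 5; 7]%N.

Definition stable_check (t : seq int) : bool :=
  let L := common_multiple t in
  grid_check 1 L 0 (blocked_by_prime t L) (nseq (size t) 0) t.

Lemma stable_tuplesP : all (fun t : 5.-tuple int => stable_check t) stable_tuples.
Proof. by vm_compute. Qed.

Lemma only_vertices_family4 V t : (0 < V)%N -> family4 V t -> only_vertices V t.
Proof.
move=> V_gt0 [/(allP stable_tuplesP) + primes_t].
rewrite /stable_check size_tuple; set L := common_multiple t => check_t.
rewrite -[V]mul1n.
apply: (grid_only_vertices (u := nseq_tuple 5 0) V_gt0 check_t).
  by move=> i; rewrite tnth_nseq mulr0 add0r.
move=> j k /(reduced_position (grid_check_gt0 check_t))[m def_V _].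
apply/hasPn=> p p_prime; apply/negP=> /andP[pL].
rewrite ltnNge primes_t //.
  by move: p_prime; rewrite !inE => /or4P[] /eqP->.
by rewrite def_V dvdn_mulr.
Qed.

(** * The tuples of a given index *)

(** With [L'] and [j'] the reduced numerator and denominator of [L / j],
    [theta = j / (I L)] and [r] the residue of [k] need [M = L' m] and
    [k = j' m] for some [m]. The point is ruled out if no [m], which matters
    only modulo [6 I], makes [M s] modulo [6] one of the residues [S] and [k]
    congruent to [r]. *)
Definition blocked_by_residue (S : seq int) (I L : nat) (s : int) (r j : nat) : bool :=
  let g := gcdn L j in
  all (fun m => (((L %/ g * m)%N%:Z * s %% 6)%Z \notin S) ||
                ((j %/ g * m) %% I != r)%N) (iota 0 (6 * I)).

(** [s] is the sign of the parameter: [m u = |m| (s u)]. *)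
Definition index_check (S : seq int) (I : nat) (u w : seq int) : bool :=
  let L := common_multiple w in
  all (fun s => grid_check I L s (blocked_by_residue S I L s) [seq s * x | x <- u] w)
    [:: 1; -1].

Lemma only_vertices_index S s I M m (u w : 5.-tuple int) :
    (0 < M)%N -> s \in [:: 1; -1] -> m = M%:Z * s -> (m %% 6)%Z \in S ->
    index_check S I u w ->
  only_vertices (I * M) (affine_tuple m u w).
Proof.
move=> M_gt0 s_sign def_m m_in_S /allP/(_ s s_sign).
set L := common_multiple w => check_uw.
apply: (grid_only_vertices (u := map_tuple ( *%R s) u) M_gt0 check_uw).
  by move=> i; rewrite tnth_mktuple tnth_map def_m mulrA.
move=> j k /(reduced_position (grid_check_gt0 check_uw))[m' def_M def_k].
have I_gt0 : (0 < I)%N by case/andP: check_uw.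
apply/allPn; exists (m' %% (6 * I))%N.
  by rewrite mem_iota /= add0n ltn_mod muln_gt0.
rewrite negb_or negbK; apply/andP; split.
  rewrite (_ : (_ %% 6)%Z = (m %% 6)%Z) // def_m def_M.
  rewrite {2}(divn_eq m' (6 * I)).
  rewrite -[RHS](modzMDl (- (L %/ gcdn L j * (m' %/ (6 * I)) * I)%N%:Z * s)).
  by congr (_ %% _)%Z; rewrite !(PoszM, PoszD); ring.
rewrite negbK def_k; apply/eqP.
by rewrite -modnMmr modn_dvdm ?dvdn_mull // modnMmr.
Qed.

Tactic Notation "residues" uconstr(S) :=
  exists (S : seq int); do 2!eexists; split;
    [by [] | unfold odd_int, even_int in *; rewrite !inE; lia | by vm_compute].

(** Each restriction on [m] only involves residues modulo [2] and [3], hence is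
    a set of residues modulo [6]. *)
Lemma index_tuple_check m I t : index_tuple m I t ->
  exists (S : seq int) (u w : 5.-tuple int),
    [/\ t = affine_tuple m u w, (m %% 6)%Z \in S & index_check S I u w].
Proof.
case=> *;
  [ residues [:: 1; 5] | residues [:: 1; 3; 5] | residues [:: 1; 3; 5]
  | residues [:: 1; 5] | residues [:: 1; 5] | residues [:: 1; 5]
  | residues [:: 2; 4] | residues [:: 2; 4] | residues [:: 0; 3]
  | residues [:: 2; 5] | residues [:: 3] | residues [:: 3; 5]
  | residues [:: 1] | residues [:: 3] | residues [:: 3] | residues [:: 5]
  | residues [:: 0]].
Qed.

Lemma only_vertices_family5 V t : (0 < V)%N -> family5 V t -> only_vertices V t.
Proof.
move=> V_gt0 [I [m [I_dvd m_def /index_tuple_check[S [u [w [-> m_in_S check_uw]]]]]]].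
have def_V : (I * (V %/ I) = V)%N by rewrite mulnC divnK.
have M_gt0 : (0 < V %/ I)%N by move: V_gt0; rewrite -{1}def_V muln_gt0 => /andP[].
rewrite -def_V; case: m_def => m_def.
  by apply: (@only_vertices_index S 1 I _ m); rewrite // m_def mulr1.
by apply: (@only_vertices_index S (-1) I _ m); rewrite // m_def mulrN1.
Qed.

(** * Emptiness of the listed simplices *)

Theorem theorem1p8 (R : realType) (B : 'M[R]_4) (hB : B \in unitmx)
    (v : 'I_5 -> 'rV[R]_4) (V : nat) (t : 5.-tuple int)
    (hv : lattice_simplex B v) (hvol : normalized_volume B v = V%:R)
    (hcyc : cyclic_simplex B v) (hrep : represents B v V t)
    (ht : [\/ family1 V t, family2 V t, family3 V t
            | family4 V t \/ family5 V t]) :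
  empty_simplex B v.
Proof.
have V_gt0 : (0 < V)%N by rewrite -(ltr0n R) -hvol normalized_volume_gt0 ?hv.1.
apply: (empty_of_only_vertices V_gt0 hv hrep).
case: ht => [||| []].
- exact: only_vertices_family1.
- exact: only_vertices_family2.
- exact: only_vertices_family3.
- exact: only_vertices_family4.
- exact: only_vertices_family5.
Qed.
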